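(* For every prime $p$ there exists a group $P$ of order $p^9$ such that $\mathcal{CD}(P)$ is a quasi-antichain of width $p + 1$ and such that: if $p = 2$ then exactly one of the three atoms of $\mathcal{CD}(P)$ is abelian; if $p \equiv 1 \pmod 4$ then exactly two of the $p + 1$ atoms of $\mathcal{CD}(P)$ are abelian; and if $p \equiv 3 \pmod 4$ then none of the atoms of $\mathcal{CD}(P)$ are abelian.
   Context: For a finite group $G$ and a subgroup $U \leq G$, the Chermak-Delgado measure of $U$ in $G$ is $m_G(U) = |U|\,|C_G(U)|$. Let $m^*(G)$ be the maximum of $m_G(U)$ over all subgroups $U \leq G$. The Chermak-Delgado lattice of $G$ is $\mathcal{CD}(G) = \{U \leq G : m_G(U) = m^*(G)\}$, ordered by inclusion (it is a sublattice of the subgroup lattice of $G$). A lattice is a quasi-antichain if it consists of a maximum, a minimum, and the atoms of the lattice (the atoms being distinct from the maximum and minimum, and pairwise incomparable); its width is the number of atoms. *)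

(* Defs.v *)
(* Mathematical Components. *)
From mathcomp Require Import all_boot all_fingroup.

Set Implicit Arguments.
Unset Strict Implicit.
Unset Printing Implicit Defensive.

Local Open Scope group_scope.

Definition cd_measure (gT : finGroupType) (G U : {group gT}) : nat :=
  (#|U| * #|'C_G(U)|)%N.

Definition cd_max (gT : finGroupType) (G : {group gT}) : nat :=
  \max_(U : {group gT} | U \subset G) cd_measure G U.

Definition cd_lattice (gT : finGroupType) (G : {group gT}) : {set {group gT}} :=
  [set U : {group gT} | (U \subset G) && (cd_measure G U == cd_max G)].

(* Below, L is a family of subgroups ordered by inclusion. *)

Definition is_minimum (gT : finGroupType) (L : {set {group gT}})
    (M : {group gT}) : bool :=
  (M \in L) && [forall U : {group gT} in L, M \subset U].

Definition is_maximum (gT : finGroupType) (L : {set {group gT}})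
    (M : {group gT}) : bool :=
  (M \in L) && [forall U : {group gT} in L, U \subset M].

Definition is_atom (gT : finGroupType) (L : {set {group gT}})
    (A : {group gT}) : bool :=
  (A \in L) &&
  [exists M : {group gT},
     [&& is_minimum L M, M \proper A
       & [forall B : {group gT} in L, ~~ ((M \proper B) && (B \proper A))]]].

Definition atoms (gT : finGroupType) (L : {set {group gT}}) : {set {group gT}} :=
  [set A : {group gT} | is_atom L A].

(* An order with a minimum and a maximum whose other elements are pairwise
   incomparable has all binary meets and joins, so being a lattice is implied. *)
Definition quasi_antichain (gT : finGroupType) (L : {set {group gT}})
    (width : nat) : Prop :=
  exists bot top : {group gT},
    [/\ is_minimum L bot,
        is_maximum L top,
        L = [set bot; top] :|: atoms L,
        [/\ bot \notin atoms L, top \notin atoms L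
          & forall A B : {group gT}, A \in atoms L -> B \in atoms L ->
              A \subset B -> A = B]
      & #|atoms L| = width].

Definition abelian_atoms (gT : finGroupType) (L : {set {group gT}}) :
    {set {group gT}} :=
  [set A : {group gT} in atoms L | abelian A].

(* Main.v *)
Require Import Defs.
From HB Require Import structures.
From mathcomp Require Import all_boot all_fingroup.
From mathcomp Require Import all_algebra all_solvable all_field ring.

Set Implicit Arguments.
Unset Strict Implicit.
Unset Printing Implicit Defensive.

Import GRing.Theory.

(** Let [F] be the field with [p] elements and [V = F^3] with its cross
    product.  The witness is the group [P] on [V * V * V] in which
    [[(u, v, z), (u', v', z')] = (0, 0, u x u' + v x v')]; it is a central
    product, with amalgamated derived subgroups, of two copies of a class-two
    group built on [V].  Let [Z = 0 * 0 * V], so that [P / Z = V (x) F^2].  The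
    claim is that [CD(P)] consists of [Z], [P] and, for each of the [p + 1]
    lines [l] of [F^2], the preimage of [V (x) l].

    The maximal measure is [p^12].  For a subgroup [U] with centraliser [C],
    project to the two coordinates in opposite orders: [U] is measured by its
    part in [Z], by [A2], its second coordinates, and by [A1], the first
    coordinates of its elements with second coordinate zero; [C] is measured by
    its part in [Z], by [B1], its first coordinates, and by [B2], the second
    coordinates of its elements with first coordinate zero.  In a commutator of
    an element counted by [A1] with one counted by [B1] only the term [u x u']
    survives, so [A1 x B1 = 0], and likewise [A2 x B2 = 0].  As [u x w = 0] with
    [u] nonzero forces [w] to be a multiple of [u], such a pair satisfies
    [|A| |B| <= p^3], with equality only when one member is [0] and the other is
    [V] ([cross_orthogonal_card]).  Multiplying, [|U| |C| <= p^12] ([cd_bound]).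

    Equality leaves four cases.  Three of them give [Z], [P] and the line
    [v = 0] at once.  In the last one, [A1 = 0] and [A2 = B1 = V], so that [U]
    is modulo [Z] the graph of a map [v |-> u]; since [u x w + v x w' = 0] can be
    solved in [w'] for every [w], taking the dot product with [v] gives
    [u x v = 0] ([cross_eq0_solvable]).  Hence every [v] is an eigenvector and
    the map is a scalar ([graph_sub_line]), which gives the remaining lines
    ([cd_extremal]).  Conversely [V (x) l] is centralised by [V (x) l'] with
    [l'] the line orthogonal to [l] for the standard dot product of [F^2]
    ([line_perp_sub_cent]), so these subgroups do reach [p^12].

    By the same token [V (x) l] is abelian exactly when [l] is isotropic for
    the form [a^2 + b^2], and the abelian atoms correspond to the square roots
    of [-1] in [F]: one if [p = 2], two if [p = 1] modulo 4, none if [p = 3]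
    modulo 4. *)

(** * Adjoining a bottom and a top to an antichain *)

Section QuasiAntichain.

Local Open Scope group_scope.

Variables (gT : finGroupType) (bot top : {group gT}) (X : {set {group gT}}).

Hypothesis X_neq0 : X != set0.
Hypothesis X_between :
  {in X, forall A : {group gT}, bot \proper A /\ A \proper top}.
Hypothesis X_antichain :
  {in X &, forall A B : {group gT}, A \subset B -> A = B}.

Let L := [set bot; top] :|: X.

Lemma bot_proper_top : bot \proper top.
Proof.
by case/set0Pn: X_neq0 => A /X_between[botA Atop]; apply: proper_trans Atop.
Qed.

Lemma is_minimum_middle : is_minimum L bot.
Proof.
rewrite /is_minimum !inE eqxx; apply/forall_inP=> U; rewrite !inE -orbA.
case/or3P=> [/eqP-> | /eqP-> | /X_between[/proper_sub //]] //.
exact: proper_sub bot_proper_top.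
Qed.

Lemma is_maximum_middle : is_maximum L top.
Proof.
rewrite /is_maximum !inE eqxx orbT; apply/forall_inP=> U; rewrite !inE -orbA.
case/or3P=> [/eqP-> | /eqP-> | /X_between[_ /proper_sub //]] //.
exact: proper_sub bot_proper_top.
Qed.

Lemma atoms_middle : atoms L = X.
Proof.
apply/setP=> A; rewrite inE; apply/andP/idP => [[LA /existsP[M]] | XA].
  case/and3P=> /andP[LM /forall_inP minM] MA /forall_inP no_between.
  have botM : bot \in L by rewrite !inE eqxx.
  have botA : bot \proper A -> A \in X.
    move=> botA; move: LA; rewrite !inE -orbA.
    case/or3P=> [/eqP eqA | /eqP eqA | //].
      by rewrite eqA properxx in botA.
    have /set0Pn[B XB] := X_neq0; have [botB Btop] := X_between XB.
    have LB : B \in L by rewrite !inE XB orbT.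
    have := no_between B LB; rewrite eqA Btop andbT.
    by rewrite (sub_proper_trans (minM _ botM) botB).
  apply: botA; apply: sub_proper_trans MA.
  have /andP[_ /forall_inP minbot] := is_minimum_middle.
  exact: minbot.
have [botA Atop] := X_between XA; split; first by rewrite !inE XA orbT.
apply/existsP; exists bot; rewrite is_minimum_middle botA /=.
apply/forall_inP=> B; rewrite !inE -orbA; apply: contraL => /andP[botB BA].
rewrite !negb_or; apply/and3P; split.
- by apply: contraL botB => /eqP->; rewrite properxx.
- by apply: contraL BA => /eqP->; rewrite properE (negPf (proper_subn Atop)).
apply: contraL BA => XB; apply/negP=> BA.
by move: (BA); rewrite (X_antichain XB XA (proper_sub BA)) properxx.
Qed.

Lemma quasi_antichain_middle : quasi_antichain L #|X|.
Proof.
exists bot, top; rewrite atoms_middle; split=> //.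
- exact: is_minimum_middle.
- exact: is_maximum_middle.
split; last exact: X_antichain.
- by apply/negP=> /X_between[]; rewrite properxx.
- by apply/negP=> /X_between[_]; rewrite properxx.
Qed.

End QuasiAntichain.

(** * Square roots of -1 in a finite field *)

Section SquareRootsOfMinusOne.

Local Open Scope ring_scope.

Variable F : finFieldType.

Definition sqrtN1 : {set F} := [set c | c ^+ 2 == -1].

Lemma card_sqrtN1_char2 : -1 = 1 :> F -> #|sqrtN1| = 1%N.
Proof.
move=> eqN11; rewrite -(cards1 (1 : F)); apply: eq_card => c.
by rewrite !inE eqN11 sqrf_eq1 eqN11 orbb.
Qed.

Lemma fermat_finField (a : F) : a != 0 -> a ^+ #|F|.-1 = 1.
Proof.
move=> a_neq0; apply: (mulfI a_neq0); rewrite -exprS mulr1 prednK ?expf_card //.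
exact: ltnW (finNzRing_gt1 F).
Qed.

(** The polynomial [X^(2k) - 1], where [|F| = 4k + 1], has too few roots to
    vanish at all nonzero elements; where it does not, [a^(2k) = -1] by Fermat,
    and [a^k] is a square root of [-1]. *)
Lemma card_sqrtN1_1mod4 : #|F| = 1 %[mod 4] -> #|sqrtN1| = 2%N.
Proof.
move=> F_mod4; pose k := (#|F| %/ 4)%N.
have cardF : #|F| = (k * 4).+1 by rewrite -addn1 [LHS](divn_eq _ 4) F_mod4.
have k_gt0 : (0 < k)%N.
  by have := finNzRing_gt1 F; rewrite cardF ltnS muln_gt0 => /andP[].
have [a a_neq0 ak_neq1] : exists2 a : F, a != 0 & a ^+ (k * 2) != 1.
  apply/exists_inP; apply: contraT; rewrite negb_exists_in => /forall_inP all1.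
  suff : (k * 4 <= k * 2)%N by rewrite leq_pmul2l.
  have -> : (k * 4)%N = size (enum [set~ 0 : F]).
    by rewrite -cardE cardsC1 cardF.
  apply: max_unity_roots (enum_uniq _); first by rewrite muln_gt0 k_gt0.
  apply/allP=> a; rewrite mem_enum !inE => /all1.
  by rewrite negbK unity_rootE.
have ak_eqN1 : a ^+ (k * 2) = -1.
  have : (a ^+ (k * 2)) ^+ 2 = 1.
    by rewrite -exprM -mulnA -[RHS](fermat_finField a_neq0) cardF.
  by move/eqP; rewrite sqrf_eq1 (negPf ak_neq1) => /eqP.
pose i := a ^+ k; have i2 : i ^+ 2 = -1 by rewrite -exprM.
(* i = - i would give - i^2 = i^2, that is 1 = -1, against ak_neq1. *)
have i_neqNi : i != - i.
  apply: contra ak_neq1 => /eqP i_eqNi; rewrite exprM -/i expr2 {1}i_eqNi mulNr.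
  by rewrite -expr2 i2 opprK.
transitivity #|[set i; - i]|; last by rewrite cards2 i_neqNi.
by apply: eq_card => c; rewrite !inE -i2 eqf_sqr.
Qed.

(** Raising [c^2 = -1] to the odd power [(|F| - 1) / 2] gives [1 = -1] by
    Fermat, which an additive group of odd order excludes. *)
Lemma card_sqrtN1_3mod4 : #|F| = 3 %[mod 4] -> #|sqrtN1| = 0%N.
Proof.
move=> F_mod4; pose k := (#|F| %/ 4)%N.
have cardF : #|F| = (k * 4).+3 by rewrite -addn3 [LHS](divn_eq _ 4) F_mod4.
have N1_neq1 : -1 != 1 :> F.
  apply/eqP=> eqN11.
  have : (#[1%R : F]%g %| 2)%N.
    by rewrite order_dvdn FinRing.zmodXgE mulr2n -{1}eqN11 addNr.
  rewrite dvdn_divisors // !inE => /orP[]; first by rewrite order_eq1 oner_eq0.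
  move=> /eqP ord1; have := order_dvdG (in_setT (1 : F)).
  by rewrite ord1 cardsT cardF dvdn2 /= negbK oddM andbF.
apply/eqP; rewrite cards_eq0; apply/eqP/setP=> c; rewrite !inE.
apply/negbTE; apply: contra N1_neq1 => /eqP c2.
have c_neq0 : c != 0.
  by apply: contra_eq_neq c2 => ->; rewrite expr0n eq_sym oppr_eq0 oner_eq0.
have := fermat_finField c_neq0.
rewrite cardF /= (_ : (k * 4).+2 = 2 * (k * 2).+1)%N; last by ring.
by rewrite exprM c2 exprS exprM sqrr_sign mulr1 => ->.
Qed.

End SquareRootsOfMinusOne.

(** * Cardinality along two morphisms *)

Section Filtration.

Local Open Scope group_scope.

(** Applied with the two coordinate projections, in one order to a subgroup
    and in the other order to its centraliser. *)
Lemma card_filtration (aT rT1 rT2 : finGroupType)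
    (f : {morphism [set: aT] >-> rT1}) (g : {morphism [set: aT] >-> rT2})
    (U : {group aT}) :
  #|U| = (#|U :&: ('ker f :&: 'ker g)|
          * (#|f @* U| * #|g @* (U :&: 'ker f)|))%N.
Proof.
rewrite !card_morphim !setTI setIA [LHS](esym (LagrangeI U ('ker f))).
by rewrite -(LagrangeI (U :&: 'ker f) ('ker g)) mulnAC mulnA.
Qed.

End Filtration.

(** * The cross product on three-dimensional space *)

Section CrossProduct.

Local Open Scope ring_scope.

Variable F : comNzRingType.
Implicit Types u v w : 'rV[F]_3.

(** The cocycle of the group law below.  Only one of the two monomials of each
    coordinate of the cross product is kept, so that the commutator form, which
    is the antisymmetrisation, is the cross product itself, in characteristic 2
    as well.  Indices are in [Z/3]. *)
Definition half_cross u v : 'rV[F]_3 :=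
  \row_i (u 0 (i + 1) * v 0 (i - 1)).

Definition cross u v := half_cross u v - half_cross v u.

Lemma half_cross0l u : half_cross 0 u = 0.
Proof. by apply/rowP=> i; rewrite !mxE mul0r. Qed.

Lemma half_cross0r u : half_cross u 0 = 0.
Proof. by apply/rowP=> i; rewrite !mxE mulr0. Qed.

Lemma cross0l u : cross 0 u = 0.
Proof. by rewrite /cross half_cross0l half_cross0r subrr. Qed.

Lemma cross0r u : cross u 0 = 0.
Proof. by rewrite /cross half_cross0l half_cross0r subrr. Qed.

Lemma crossDl u v w : cross (u + v) w = cross u w + cross v w.
Proof. by apply/rowP=> i; rewrite !mxE; ring. Qed.

Lemma crossDr u v w : cross u (v + w) = cross u v + cross u w.
Proof. by apply/rowP=> i; rewrite !mxE; ring. Qed.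

Lemma crossZl a u v : cross (a *: u) v = a *: cross u v.
Proof. by apply/rowP=> i; rewrite !mxE; ring. Qed.

Lemma crossZr a u v : cross u (a *: v) = a *: cross u v.
Proof. by apply/rowP=> i; rewrite !mxE; ring. Qed.

Lemma crossC u v : cross u v = - cross v u.
Proof. by rewrite /cross opprB. Qed.

Lemma crossvv u : cross u u = 0.
Proof. exact: subrr. Qed.

Lemma cross_delta (i : 'I_3) :
  cross (delta_mx 0 i) (delta_mx 0 (i + 1)) = delta_mx 0 (i - 1).
Proof.
apply/rowP=> j; rewrite !mxE /=.
by case: i j => [[|[|[|//]]] ?] [[|[|[|//]]] ?];
  rewrite !eqE /= ?(mulr0, mul0r, mulr1, subr0, subrr).
Qed.

Lemma triple_product u v w :
  \sum_i cross u v 0 i * w 0 i = \sum_i cross w u 0 i * v 0 i.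
Proof.
have sum3 (f : 'I_3 -> F) : \sum_i f i = f 0 + (f 1 + f (- 1)).
  by rewrite !big_ord_recl big_ord0 addr0; do ![congr (_ + _)]; congr (f _);
    apply: val_inj.
have two : 1 + 1 = - 1 :> 'I_3 by apply: val_inj.
have mtwo : - 1 - 1 = 1 :> 'I_3 by apply: val_inj.
by rewrite !sum3 !mxE add0r sub0r two mtwo subrr addNr; ring.
Qed.

Lemma cross_eq0_minors u v : cross u v = 0 ->
  forall i j, u 0 i * v 0 j = u 0 j * v 0 i.
Proof.
move=> /rowP uv0.
have minor i : u 0 (i + 1) * v 0 (i - 1) = u 0 (i - 1) * v 0 (i + 1).
  by have /eqP := uv0 i; rewrite !mxE subr_eq0 => /eqP ->; rewrite mulrC.
have cyc i : u 0 i * v 0 (i + 1) = u 0 (i + 1) * v 0 i.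
  have:= minor (i - 1); rewrite subrK.
  suff -> : i - 1 - 1 = i + 1 by [].
  by case: i => [[|[|[|//]]] ?]; apply: val_inj.
move=> i j.
have [->|->|->] : [\/ j = i, j = i + 1 | i = j + 1].
  by case: i j => [[|[|[|//]]] ?] [[|[|[|//]]] ?];
    (exact: Or31 (val_inj _) || exact: Or32 (val_inj _)
     || exact: Or33 (val_inj _)).
- by [].
- exact: cyc.
- by rewrite cyc.
Qed.

End CrossProduct.

(** * Collinearity over a field *)

Section Collinearity.

Local Open Scope ring_scope.

Variable F : fieldType.
Implicit Types u v w : 'rV[F]_3.

Lemma cross_eq0_collinear u v :
  u != 0 -> cross u v = 0 -> exists c, v = c *: u.
Proof.
move=> u_neq0 /cross_eq0_minors minors.
have /rV0Pn[i ui_neq0] := u_neq0.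
exists (v 0 i / u 0 i); apply/rowP=> j.
by rewrite mxE mulrAC [v 0 i * _]mulrC -minors mulrC mulKf.
Qed.

Lemma dot_eq0 u : (forall w, \sum_i u 0 i * w 0 i = 0) -> u = 0.
Proof.
move=> u_dot; apply/rowP=> i; rewrite mxE.
have:= u_dot (delta_mx 0 i).
rewrite (bigD1 i) //= mxE !eqxx mulr1 big1 ?addr0 //.
by move=> j /negPf j_neq_i; rewrite mxE j_neq_i andbF mulr0.
Qed.

(** Take the dot product of [u x w + v x w' = 0] with [v]: the second term is
    orthogonal to [v], and the first becomes [w . (v x u)].  This then vanishes
    for every [w]. *)
Lemma cross_eq0_solvable u v :
  (forall w, exists w', cross u w + cross v w' = 0) -> cross u v = 0.
Proof.
move=> shared; apply/dot_eq0 => w; have [w' uw_vw'] := shared w.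
have wu_vw' : cross w u = cross v w'.
  by rewrite crossC; apply/eqP; rewrite eqr_oppLR -addr_eq0 uw_vw'.
rewrite triple_product wu_vw' triple_product big1 // => i _.
by rewrite crossvv mxE mul0r.
Qed.

End Collinearity.

(** * The group *)

Section CrossGroup.

Local Open Scope ring_scope.

Variable F : finFieldType.

Definition cross_group : Type := ('rV[F]_3 * 'rV[F]_3 * 'rV[F]_3)%type.

HB.instance Definition _ := Finite.on cross_group.

Implicit Types x y : cross_group.

Definition cross_group_mul x y : cross_group :=
  (x.1.1 + y.1.1, x.1.2 + y.1.2,
   x.2 + y.2 + (half_cross x.1.1 y.1.1 + half_cross x.1.2 y.1.2)).

Definition cross_group_inv x : cross_group :=
  (- x.1.1, - x.1.2,
   - x.2 + (half_cross x.1.1 x.1.1 + half_cross x.1.2 x.1.2)).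

Lemma cross_group_mulA : associative cross_group_mul.
Proof.
move=> [[u v] z] [[u' v'] z'] [[u'' v''] z''].
by congr (_, _, _); apply/rowP=> i; rewrite !mxE /=; ring.
Qed.

Lemma cross_group_mul1 : left_id (0, 0, 0) cross_group_mul.
Proof.
move=> [[u v] z].
by congr (_, _, _); apply/rowP=> i; rewrite !mxE /=; ring.
Qed.

Lemma cross_group_mulV :
  left_inverse (0, 0, 0) cross_group_inv cross_group_mul.
Proof.
move=> [[u v] z].
by congr (_, _, _); apply/rowP=> i; rewrite !mxE /=; ring.
Qed.

HB.instance Definition _ :=
  Finite_isGroup.Build cross_group
    cross_group_mulA cross_group_mul1 cross_group_mulV.

(** One family of morphisms serves for both coordinate projections and, through
    its kernels, for the subgroups [V (x) l]. *)
Definition lin (a b : F) x : 'rV[F]_3 := a *: x.1.1 + b *: x.1.2.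

Lemma lin_morphM a b :
  {in [set: cross_group] &, {morph lin a b : x y / (x * y)%g >-> (x * y)%g}}.
Proof.
by move=> x y _ _; apply/rowP=> i; rewrite !mxE /=; ring.
Qed.

Canonical lin_morphism a b := Morphism (lin_morphM a b).

Lemma commute_crossP x y :
  commute x y <-> cross x.1.1 y.1.1 + cross x.1.2 y.1.2 = 0.
Proof.
rewrite /cross addrACA -opprD.
split=> [[_ _] | /eqP].
  by rewrite [y.2 + _]addrC => /addrI ->; rewrite subrr.
rewrite subr_eq0 => /eqP eq_z.
by congr (_, _, _); rewrite /= ?eq_z addrC // [y.2 + _]addrC addrC.
Qed.

End CrossGroup.

(** * The Chermak-Delgado lattice of the group *)

Section ChermakDelgado.

Local Open Scope group_scope.

Variable F : finFieldType.
Local Notation V := 'rV[F]_3.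
Local Notation gT := (cross_group F).
Local Notation q := #|F|.

Lemma q_gt1 : (1 < q)%N. Proof. exact: finNzRing_gt1. Qed.

Lemma q_gt0 : (0 < q)%N. Proof. exact: ltnW q_gt1. Qed.

Lemma cardV : #|{: V}| = (q ^ 3)%N.
Proof. by rewrite card_mx mul1n. Qed.

Lemma card_cross_group : #|[set: gT]| = (q ^ 9)%N.
Proof. by rewrite cardsT /cross_group !card_prod cardV -!expnD. Qed.

Lemma card_cross_annihilator (u : V) (B : {set V}) :
  u != 0%R -> {in B, forall v, cross u v = 0%R} -> #|B| <= q.
Proof.
move=> u_neq0 uB; apply: leq_trans (leq_imset_card (fun c => c *: u)%R F).
apply: subset_leq_card; apply/subsetP => v /uB.
by case/(cross_eq0_collinear u_neq0) => c ->; apply: imset_f.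
Qed.

Definition extreme_pair (A B : {group V}) : bool :=
  ((A == 1%G) && (B == [set: V]%G)) || ((A == [set: V]%G) && (B == 1%G)).

(** If neither member is trivial, a nonzero element of each confines the other
    to the line that it spans, and [q^2 < q^3]. *)
Lemma cross_orthogonal_card (A B : {group V}) :
  {in A & B, forall u v, cross u v = 0%R} ->
  #|A| * #|B| <= q ^ 3 ?= iff extreme_pair A B.
Proof.
rewrite /extreme_pair.
move=> orthoAB; have V_neq1 : 1%G != [set: V]%G.
  apply/eqP=> /(congr1 (fun G : {group V} => #|G|)) /eqP.
  rewrite /= cards1 cardsT cardV eq_sym -(exp1n 3) eqn_exp2r //.
  by rewrite gtn_eqF ?q_gt1.
have subT (G : {group V}) : #|G| <= q ^ 3 ?= iff (G == [set: V]%G).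
  by have := subset_leqif_cards (subsetT G); rewrite cardsT cardV.
case: (eqVneq A 1%G) orthoAB => [-> _ | A_neq1 orthoAB].
  by rewrite cards1 mul1n (negPf V_neq1) orbF; apply: subT.
case: (eqVneq B 1%G) orthoAB => [-> _ | B_neq1 orthoAB].
  by rewrite cards1 muln1 (negPf V_neq1) andbT; apply: subT.
rewrite andbF; apply/leqifP.
have /trivgPn[u Au u_neq0] := A_neq1; have /trivgPn[v Bv v_neq0] := B_neq1.
have leA : #|A| <= q.
  apply: (card_cross_annihilator v_neq0) => w Aw.
  by rewrite crossC orthoAB // oppr0.
have leB : #|B| <= q.
  by apply: (card_cross_annihilator u_neq0) => w; apply: orthoAB.
by apply: leq_ltn_trans (leq_mul leA leB) _; rewrite mulnn ltn_exp2l ?q_gt1.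
Qed.

Definition pi1 : {morphism [set: gT] >-> V} := lin_morphism 1%R 0%R.
Definition pi2 : {morphism [set: gT] >-> V} := lin_morphism 0%R 1%R.

Lemma pi1E (x : gT) : pi1 x = x.1.1.
Proof. by rewrite /= /lin scale1r scale0r addr0. Qed.

Lemma pi2E (x : gT) : pi2 x = x.1.2.
Proof. by rewrite /= /lin scale1r scale0r add0r. Qed.

Lemma ker_pi1E (x : gT) : (x \in 'ker pi1) = (x.1.1 == 0%R).
Proof. by rewrite -pi1E !inE. Qed.

Lemma ker_pi2E (x : gT) : (x \in 'ker pi2) = (x.1.2 == 0%R).
Proof. by rewrite -pi2E !inE. Qed.

Definition cross_center : {group gT} := ('ker pi1 :&: 'ker pi2)%G.

Lemma cross_centerE (x : gT) :
  (x \in cross_center) = (x.1.1 == 0%R) && (x.1.2 == 0%R).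
Proof. by rewrite in_setI ker_pi1E ker_pi2E. Qed.

Lemma card_cross_center : #|cross_center| = (q ^ 3)%N.
Proof.
pose f (z : V) : gT := (0%R, 0%R, z).
have f_inj : injective f by move=> z z' [].
rewrite -cardV -(card_imset _ f_inj).
apply: eq_card => -[[u v] z]; rewrite cross_centerE /=.
apply/idP/imsetP => [/andP[/eqP-> /eqP->] | [z' _ [-> -> _]]].
  by exists z.
by rewrite eqxx.
Qed.

Lemma cent_crossP (U : {group gT}) y :
  reflect {in U, forall x, cross x.1.1 y.1.1 + cross x.1.2 y.1.2 = 0}%R
          (y \in 'C(U)).
Proof.
apply: (iffP centP) => cUy x Ux; last exact/commute_sym/commute_crossP/cUy.
exact/commute_crossP/commute_sym/cUy.
Qed.

Lemma cross_center_sub_cent : cross_center \subset 'C([set: gT]).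
Proof.
apply/subsetP=> z; rewrite cross_centerE => /andP[/eqP z1 /eqP z2].
by apply/cent_crossP=> x _; rewrite z1 z2 !cross0r addr0.
Qed.

(** The two filtrations run in opposite directions, so that for each [i] the
    commutator of an element counted by [Ai] with one counted by [Bi] reduces to
    a single cross product. *)
Lemma cd_bound (U : {group gT}) (C := 'C(U)%G)
    (A1 := [group of pi1 @* (U :&: 'ker pi2)]) (A2 := [group of pi2 @* U])
    (B1 := [group of pi1 @* C]) (B2 := [group of pi2 @* (C :&: 'ker pi1)]) :
  cd_measure [set: gT]%G U <= q ^ 12
    ?= iff [&& cross_center \subset U, extreme_pair A1 B1 & extreme_pair A2 B2].
Proof.
have ortho1 : {in A1 & B1, forall u v, cross u v = 0%R}.
  move=> _ _ /morphimP[x _ /setIP[Ux kx] ->] /morphimP[y _ /cent_crossP cUy ->].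
  have:= cUy x Ux; move: kx; rewrite ker_pi2E !pi1E.
  by move/eqP->; rewrite cross0l addr0.
have ortho2 : {in A2 & B2, forall u v, cross u v = 0%R}.
  move=> _ _ /morphimP[x _ Ux ->] /morphimP[y _ /setIP[/cent_crossP cUy ky] ->].
  have:= cUy x Ux; move: ky; rewrite ker_pi1E !pi2E.
  by move/eqP->; rewrite cross0r add0r.
have leU : #|U :&: cross_center| <= q ^ 3 ?= iff (cross_center \subset U).
  rewrite -card_cross_center (sameP setIidPr eqP).
  exact/subset_leqif_cards/subsetIr.
have leC : #|C :&: cross_center| <= q ^ 3 ?= iff true.
  rewrite -card_cross_center (_ : true = (C :&: cross_center == cross_center)).
    exact/subset_leqif_cards/subsetIr.
  exact/esym/eqP/setIidPr/(subset_trans cross_center_sub_cent)/centS/subsetT.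
have -> : cd_measure [set: gT]%G U =
    (#|U :&: cross_center| * #|C :&: cross_center|
     * (#|A1| * #|B1| * (#|A2| * #|B2|)))%N.
  rewrite /cd_measure setTI (card_filtration pi2 pi1).
  rewrite [#|'C(U)|](card_filtration pi1 pi2).
  rewrite ['ker pi2 :&: _]setIC.
  have -> (a b c d e f : nat) :
      (a * (b * c) * (d * (e * f)) = a * d * (c * e * (b * f)))%N by ring.
  by [].
have:= leqif_mul (leqif_mul leU leC)
  (leqif_mul (cross_orthogonal_card ortho1) (cross_orthogonal_card ortho2)).
rewrite -!expnD !expn_eq0 (gtn_eqF q_gt0) /= andbT; apply.
Qed.

Definition line (d : F * F) : {group gT} := 'ker (lin_morphism d.2 (- d.1)%R).

Lemma lineE d (x : gT) : (x \in line d) = (d.2 *: x.1.1 == d.1 *: x.1.2)%R.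
Proof. by rewrite !inE /= /lin scaleNr subr_eq0. Qed.

(** The points of the projective line over [F], [None] being the point at
    infinity. *)
Definition direction (o : option F) : F * F :=
  if o is Some c then (c, 1)%R else (1, 0)%R.

Definition proj_line o := line (direction o).

Lemma mem_proj_line o (x : gT) :
  reflect (exists w, x.1 = ((direction o).1 *: w, (direction o).2 *: w)%R)
          (x \in proj_line o).
Proof.
rewrite lineE; case: x => -[u v] z /=.
apply: (iffP eqP) => [|[w [-> ->]]]; last by rewrite !scalerA mulrC.
case: o => [c|] /=; rewrite ?scale1r ?scale0r => eq_uv.
  by exists v; rewrite scale1r eq_uv.
by exists u; rewrite scale1r -eq_uv scale0r.
Qed.

Lemma card_proj_line o : #|proj_line o| = (q ^ 6)%N.
Proof.
pose f (wz : V * V) : gT :=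
  ((direction o).1 *: wz.1, (direction o).2 *: wz.1, wz.2)%R.
have f_inj : injective f.
  move=> [w z] [w' z']; rewrite {}/f; case: o => [c|] /=; rewrite !scale1r.
    by move=> [_ -> ->].
  by move=> [-> _ ->].
have -> : proj_line o = f @: setT :> {set gT}.
  apply/setP=> -[uv z].
  apply/mem_proj_line/imsetP => [[w /= ->] | [[w z'] _ [-> _]]].
    by exists (w, z).
  by exists w.
by rewrite (card_imset _ f_inj) cardsT card_prod cardV -expnD.
Qed.

Definition proj_lines : {set {group gT}} := [set proj_line o | o : option F].

Definition cd_members : {set {group gT}} :=
  [set cross_center; [set: gT]%G] :|: proj_lines.

Definition perp d : F * F := (- d.2, d.1)%R.

(** On vectors [d (x) w] and [e (x) w'] the commutator form is
    [(d . e) (w x w')]. *)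
Lemma line_perp_sub_cent o : line (perp (direction o)) \subset 'C(proj_line o).
Proof.
apply/subsetP=> y; rewrite lineE /= => /eqP y_perp.
apply/cent_crossP=> x /mem_proj_line[w ->] /=.
rewrite !crossZl -!crossZr y_perp -crossDr scaleNr addNr.
by rewrite cross0r.
Qed.

(** Only a lower bound is proved, because it follows for every [d] from
    counting values; it suffices since [cd_bound] is an upper bound. *)
Lemma card_line_ge d : q ^ 6 <= #|line d|.
Proof.
have := card_morphim (lin_morphism d.2 (- d.1)%R) [set: gT].
rewrite setTI => im_card.
have := LagrangeI [set: gT] (line d).
rewrite setTI -im_card card_cross_group => card_eq.
rewrite -(@leq_pmul2r (q ^ 3)) ?expn_gt0 ?q_gt0 // -expnD -card_eq.
rewrite leq_pmul2l //.
by rewrite -cardV max_card.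
Qed.

Lemma cd_members_measure (U : {group gT}) :
  U \in cd_members -> q ^ 12 <= cd_measure [set: gT]%G U.
Proof.
rewrite /cd_measure setTI !inE -orbA => /or3P[/eqP->|/eqP->|/imsetP[o _ ->]].
- rewrite card_cross_center -[12]/(3 + 9)%N expnD leq_mul // -card_cross_group.
  apply/subset_leq_card; rewrite centsC; exact: cross_center_sub_cent.
- rewrite card_cross_group -[12]/(9 + 3)%N expnD leq_mul // -card_cross_center.
  exact/subset_leq_card/cross_center_sub_cent.
rewrite card_proj_line -[12]/(6 + 6)%N expnD leq_mul //.
apply: leq_trans (card_line_ge (perp (direction o))) _.
exact/subset_leq_card/line_perp_sub_cent.
Qed.

Lemma delta_neq0 (i : 'I_3) : (delta_mx 0 i : V)%R != 0%R.
Proof.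
by apply/eqP=> /matrixP/(_ 0%R i); rewrite !mxE !eqxx => /eqP; rewrite oner_eq0.
Qed.

(** An additive map of which every vector is an eigenvector is a scalar:
    comparing [v], [v'] and [v + v'] shows that independent vectors have the
    same eigenvalue. *)
Lemma graph_sub_line (U : {group gT}) :
  pi2 @* U = [set: V] -> {in U, forall x, exists c, x.1.1 = c *: x.1.2}%R ->
  exists c, U \subset proj_line (Some c).
Proof.
move=> U_onto U_eigen.
have sameP x y c d : x \in U -> y \in U -> (x.1.1 = c *: x.1.2)%R ->
  (y.1.1 = d *: y.1.2)%R -> cross x.1.2 y.1.2 != 0%R -> c = d.
  move=> Ux Uy x_c y_d xy_indep; have [e /= xy_e] := U_eigen _ (groupM Ux Uy).
  have : (cross (x.1.1 + y.1.1) (x.1.2 + y.1.2) = 0)%R.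
    by rewrite xy_e crossZl crossvv scaler0.
  rewrite x_c y_d crossDl !crossDr !crossZl !crossvv !scaler0 addr0 add0r.
  rewrite [cross y.1.2 _]crossC scalerN -scalerBl => /eqP.
  by rewrite scaler_eq0 (negPf xy_indep) orbF subr_eq0 => /eqP.
have lift v : exists2 x, x \in U & x.1.2 = v.
  have /morphimP[x _ Ux ->] : v \in pi2 @* U by rewrite U_onto inE.
  by exists x; rewrite ?pi2E.
have [x Ux x2] := lift (delta_mx 0 0)%R.
have [x' Ux' x'2] := lift (delta_mx 0 1)%R.
have [c x_c] := U_eigen x Ux; have [c' x'_c'] := U_eigen x' Ux'.
have cross_xx' : cross x.1.2 x'.1.2 != 0%R.
  have := @cross_delta F 0%R; rewrite x2 x'2 add0r => ->.
  exact: delta_neq0.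
(* The eigenvalue of y is compared with that of x; when their second
   coordinates are collinear, x' is independent of both and links them. *)
exists c; apply/subsetP=> y Uy; rewrite lineE /= scale1r.
have [d y_d] := U_eigen y Uy.
have [xy0 | xy_neq0] := eqVneq (cross x.1.2 y.1.2) 0%R; last first.
  by rewrite (sameP _ _ _ _ Ux Uy x_c y_d xy_neq0) y_d.
have [k y2] : exists k, (y.1.2 = k *: x.1.2)%R.
  by apply: cross_eq0_collinear xy0; rewrite x2 delta_neq0.
have [k0 | k_neq0] := eqVneq k 0%R; first by rewrite y_d y2 k0 scale0r !scaler0.
rewrite (sameP _ _ _ _ Ux Ux' x_c x'_c' cross_xx').
rewrite (sameP _ _ _ _ Ux' Uy x'_c' y_d) ?y_d //.
by rewrite y2 crossZr scaler_eq0 negb_or k_neq0 crossC oppr_eq0.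
Qed.

Lemma cd_extremal (U : {group gT}) :
  cd_measure [set: gT]%G U = (q ^ 12)%N -> U \in cd_members.
Proof.
move/eqP; rewrite (cd_bound U).2 => /and3P[sZU cond1 cond2].
have := card_filtration pi2 pi1 U.
rewrite ['ker pi2 :&: _]setIC -/(gval cross_center) (setIidPr sZU).
rewrite card_cross_center => cardU.
rewrite /cd_members !inE -orbA.
have memb (H : {group gT}) n : U \subset H -> #|H| = n -> #|U| = n -> U == H.
  by move=> sUH cH cU; rewrite -val_eqE /= eqEcard sUH cH cU /=.
case/orP: cond1 cond2 => /andP[/eqP/(congr1 val)/= A1 /eqP/(congr1 val)/= B1];
  case/orP=> /andP[/eqP/(congr1 val)/= A2 /eqP/(congr1 val)/= B2];
  rewrite A1 A2 ?cards1 ?cardsT ?cardV ?muln1 ?mul1n -?expnD in cardU.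
- by rewrite eq_sym -val_eqE /= eqEcard sZU card_cross_center cardU leqnn.
  (* U is a graph over the second coordinate. *)
- have U_eigen : {in U, forall x, exists c, x.1.1 = c *: x.1.2}%R.
    move=> x Ux; have [x2_0 | x2_neq0] := eqVneq x.1.2 0%R.
      exists 0%R; rewrite scale0r.
      have : pi1 x \in pi1 @* (U :&: 'ker pi2).
        by rewrite mem_morphim ?in_setT // in_setI Ux ker_pi2E x2_0 eqxx.
      by rewrite A1 => /set1P; rewrite pi1E.
    apply: cross_eq0_collinear x2_neq0 _.
    rewrite crossC cross_eq0_solvable ?oppr0 // => w.
    have : w \in pi1 @* 'C(U) by rewrite B1 inE.
    case/morphimP=> y _ /cent_crossP cUy ->; exists y.1.2.
    by rewrite pi1E cUy.
  have [c sUc] := graph_sub_line A2 U_eigen.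
  apply/or3P/Or33/imsetP; exists (Some c) => //; apply/eqP.
  exact: memb sUc (card_proj_line _) cardU.
- have sU : U \subset proj_line None.
    apply/subsetP=> x Ux; rewrite lineE /= scale0r scale1r eq_sym.
    have : pi2 x \in pi2 @* U by rewrite mem_morphim ?in_setT.
    by rewrite A2 => /set1P; rewrite pi2E => ->.
  apply/or3P/Or33/imsetP; exists None => //; apply/eqP.
  exact: memb sU (card_proj_line _) cardU.
by rewrite (memb [set: gT]%G _ (subsetT _) card_cross_group cardU) orbT.
Qed.

Lemma cd_measure_leqif (U : {group gT}) :
  cd_measure [set: gT]%G U <= q ^ 12 ?= iff (U \in cd_members).
Proof.
split; first exact: (cd_bound U).1.
apply/eqP/idP => [/cd_extremal // | /cd_members_measure measU].
by apply/eqP; rewrite eqn_leq (cd_bound U).1.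
Qed.

Lemma cd_lattice_cross_group : cd_lattice [set: gT]%G = cd_members.
Proof.
have max_eq : cd_max [set: gT]%G = (q ^ 12)%N.
  apply/eqP; rewrite eqn_leq; apply/andP; split.
    by apply/bigmax_leqP=> U _; apply: (cd_measure_leqif U).1.
  have /eqP<- : cd_measure [set: gT]%G [set: gT]%G == (q ^ 12)%N.
    by rewrite (cd_measure_leqif _).2 !inE eqxx orbT.
  exact: leq_bigmax_cond.
by apply/setP=> U; rewrite inE subsetT max_eq (cd_measure_leqif U).2.
Qed.

Lemma proj_line_inj : injective proj_line.
Proof.
move=> o o' eq_oo'; pose w : V := delta_mx 0%R 0%R.
have w_neq0 : w != 0%R by exact: delta_neq0.
have : ((direction o).1 *: w, (direction o).2 *: w, 0%R)%R \in proj_line o'.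
  by rewrite -eq_oo'; apply/mem_proj_line; exists w.
rewrite lineE /= !scalerA -subr_eq0 -scalerBl scaler_eq0 (negPf w_neq0) orbF.
rewrite subr_eq0.
case: o o' {eq_oo'} => [c|] [c'|] //=; rewrite ?mul1r ?mulr1 ?mul0r ?mulr0.
- by move/eqP->.
- by rewrite eq_sym oner_eq0.
- by rewrite oner_eq0.
Qed.

(** On [V (x) <d>] the commutator form is [(d . d) (w x w')], and the cross
    product is not identically zero. *)
Lemma abelian_proj_line o :
  abelian (proj_line o) = (if o is Some c then c ^+ 2 == -1 else false)%R.
Proof.
pose lift w : gT := ((direction o).1 *: w, (direction o).2 *: w, 0%R)%R.
have mem_lift w : lift w \in proj_line o by apply/mem_proj_line; exists w.
have -> : abelian (proj_line o) =
    ((direction o).1 ^+ 2 + (direction o).2 ^+ 2 == 0)%R.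
  apply/idP/eqP => [/subsetP abel | isotropic].
    pose e (i : 'I_3) : V := delta_mx 0%R i.
    have /cent_crossP := abel _ (mem_lift (e 1%R)).
    move/(_ _ (mem_lift (e 0%R))).
    rewrite /= !crossZl !crossZr !scalerA -scalerDl.
    have := @cross_delta F 0%R; rewrite add0r => -> /eqP.
    by rewrite scaler_eq0 (negPf (delta_neq0 _)) orbF -!expr2 => /eqP.
  rewrite /abelian; apply/subsetP=> y /mem_proj_line[w' y1].
  apply/cent_crossP=> x /mem_proj_line[w x1].
  rewrite x1 y1 /= !crossZl !crossZr !scalerA -scalerDl -!expr2 isotropic.
  exact: scale0r.
case: o {lift mem_lift} => [c|] /=; first by rewrite expr1n addr_eq0.
by rewrite expr1n expr0n addr0 oner_eq0.
Qed.

Lemma cross_center_proper_proj_line o : cross_center \proper proj_line o.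
Proof.
rewrite properEcard card_cross_center card_proj_line ltn_exp2l ?q_gt1 // andbT.
apply/subsetP=> z; rewrite cross_centerE lineE => /andP[/eqP-> /eqP->].
by rewrite !scaler0.
Qed.

Lemma proj_line_proper_setT o : proj_line o \proper [set: gT].
Proof.
by rewrite properEcard subsetT card_cross_group card_proj_line ltn_exp2l ?q_gt1.
Qed.

Lemma proj_lines_neq0 : proj_lines != set0.
Proof. by apply/set0Pn; exists (proj_line None); apply: imset_f. Qed.

Lemma proj_lines_between :
  {in proj_lines, forall A : {group gT},
     cross_center \proper A /\ A \proper [set: gT]}.
Proof.
move=> _ /imsetP[o _ ->].
by rewrite cross_center_proper_proj_line proj_line_proper_setT.
Qed.

Lemma proj_lines_antichain :
  {in proj_lines &, forall A B : {group gT}, A \subset B -> A = B}.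
Proof.
move=> _ _ /imsetP[o _ ->] /imsetP[o' _ ->] sub_oo'.
by apply/val_inj/eqP; rewrite eqEcard sub_oo' !card_proj_line /=.
Qed.

Lemma atoms_cross_group : atoms (cd_lattice [set: gT]%G) = proj_lines.
Proof.
by rewrite cd_lattice_cross_group
  (atoms_middle proj_lines_neq0 proj_lines_between proj_lines_antichain).
Qed.

Lemma quasi_antichain_cross_group :
  quasi_antichain (cd_lattice [set: gT]%G) q.+1.
Proof.
rewrite cd_lattice_cross_group -card_option -(card_imset _ proj_line_inj).
exact: quasi_antichain_middle proj_lines_neq0 proj_lines_between
  proj_lines_antichain.
Qed.

Lemma card_abelian_atoms :
  #|abelian_atoms (cd_lattice [set: gT]%G)| = #|sqrtN1 F|.
Proof.
rewrite /abelian_atoms atoms_cross_group.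
rewrite -(card_imset _ (inj_comp proj_line_inj (@Some_inj _))).
apply: eq_card => A; rewrite inE.
apply/andP/imsetP => [[/imsetP[o _ ->]] | [c]].
  by rewrite abelian_proj_line; case: o => // c c2; exists c; rewrite ?inE.
rewrite inE => c2 ->; split; first exact: imset_f.
by rewrite abelian_proj_line.
Qed.

End ChermakDelgado.

Theorem proposition10 (p : nat) (p_pr : prime p) :
  exists (gT : finGroupType) (P : {group gT}),
    [/\ #|P| = (p ^ 9)%N,
        quasi_antichain (cd_lattice P) p.+1,
        p = 2 -> #|abelian_atoms (cd_lattice P)| = 1%N,
        p = 1 %[mod 4] -> #|abelian_atoms (cd_lattice P)| = 2
      & p = 3 %[mod 4] -> #|abelian_atoms (cd_lattice P)| = 0%N].
Proof.
have cardF : #|'F_p| = p := card_Fp p_pr.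
exists (cross_group 'F_p), [set: cross_group 'F_p]%G.
rewrite card_abelian_atoms card_cross_group cardF; split=> //.
- by have := quasi_antichain_cross_group 'F_p; rewrite cardF.
- move=> p2; apply: card_sqrtN1_char2.
  by move: p_pr; rewrite p2 => _; apply: val_inj.
- by move=> p1; rewrite card_sqrtN1_1mod4 ?cardF.
- by move=> p3; rewrite card_sqrtN1_3mod4 ?cardF.
Qed.
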